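(* Let $s\in\Sigma^n$ be primitive and suppose $M_{*}(s)$ is based on a $\pm$ ordering with respect to a permutation $\pi$ of $\Sigma$ (with known choice of $\pi_y\in\{\pi,\pi^R\}$ for each string $y$). Given $BWT_{*}(s)$ with constant-time rank support and the index $i$ of the row of $M_{*}(s)$ equal to $s$, the original string $s$ can be retrieved in ${\cal O}(|s|^2)$ time and ${\cal O}(|s|)$ working space.
   Context: For every string $y$ over $\Sigma$ let $\pi_y$ be a total order of $\Sigma$. $M_{*}(s)$ is the matrix whose rows (numbered $1,\dots,n$ top to bottom) are the cyclic rotations of $s$ (primitive: all rotations distinct), sorted so that for distinct rotations $u\neq v$ with longest common prefix $y$ and next symbols $a$ (in $u$) and $b$ (in $v$), $u$ precedes $v$ iff $a$ precedes $b$ in $\pi_y$; $BWT_{*}(s)$ is its last column. $\pi^R$ is the reversal of $\pi$. $M_{*}(s)$ is based on a $\pm$ ordering if $\pi_y\in\{\pi,\pi^R\}$ for every $y$. Constant-time rank support: $\mathsf{rank}_c(L,j)$ (number of $c$'s in $L[1,j]$) answered in ${\cal O}(1)$ time. Model: word RAM with word size $w$, $\sigma=w^{{\cal O}(1)}$. *)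

(* Defs.v *)
From mathcomp Require Import all_boot all_fingroup.

Set Implicit Arguments.
Unset Strict Implicit.
Unset Printing Implicit Defensive.

(* ** Orders of the alphabet and the generalized Burrows-Wheeler matrix *)

(* A total order of Sigma = 'I_sigma is encoded by the permutation that sends
   each symbol to its position in the order. *)
Definition alpha_order (sigma : nat) : Type := {perm 'I_sigma}.

Definition precedes (sigma : nat) (p : alpha_order sigma) : rel 'I_sigma :=
  fun a b => p a < p b.

Definition reversal (sigma : nat) (p : alpha_order sigma) : alpha_order sigma :=
  (p * perm (@rev_ord_inj sigma))%g.

Lemma precedes_reversal (sigma : nat) (p : alpha_order sigma) (a b : 'I_sigma) :
  precedes (reversal p) a b = precedes p b a.
Proof. by rewrite /precedes !permM !permE /= ltn_sub2lE // ltnS. Qed.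

Definition local_orders (sigma : nat) : Type := seq 'I_sigma -> alpha_order sigma.

(* [y] is the common prefix already read; row_le_cat below is the defining
   property. The relation is only used on strings of equal length. *)
Fixpoint row_le_from (sigma : nat) (ord : local_orders sigma)
    (y u v : seq 'I_sigma) : bool :=
  match u, v with
  | a :: u', b :: v' =>
      if a == b then row_le_from ord (rcons y a) u' v' else precedes (ord y) a b
  | _, _ => true
  end.

Definition row_le (sigma : nat) (ord : local_orders sigma) : rel (seq 'I_sigma) :=
  row_le_from ord [::].

Lemma row_le_cat (sigma : nat) (ord : local_orders sigma)
    (y u v : seq 'I_sigma) (a b : 'I_sigma) :
  a != b -> row_le ord (y ++ a :: u) (y ++ b :: v) = precedes (ord y) a b.
Proof.
move=> neq_ab; rewrite /row_le -[y in ord y]cat0s.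
elim: y [::] => [|c y IHy] x /=; first by rewrite (negPf neq_ab) cats0.
by rewrite eqxx IHy cat_rcons.
Qed.

Lemma row_le_total (sigma : nat) (ord : local_orders sigma) : total (row_le ord).
Proof.
rewrite /row_le => u v; elim: u v [::] => [|a u IHu] [|b v] y //=.
rewrite [b == a]eq_sym; have [-> // | neq_ab] := eqVneq a b.
by rewrite /precedes -neq_ltn (inj_eq val_inj) (inj_eq perm_inj).
Qed.

Definition rotations (sigma : nat) (s : seq 'I_sigma) : seq (seq 'I_sigma) :=
  [seq rot k s | k <- iota 0 (size s)].

Definition primitive_string (sigma : nat) (s : seq 'I_sigma) : bool :=
  uniq (rotations s).

Definition bwt_matrix (sigma : nat) (ord : local_orders sigma)
    (s : seq 'I_sigma) : seq (seq 'I_sigma) :=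
  sort (row_le ord) (rotations s).

Definition bwt (sigma : nat) (ord : local_orders sigma)
    (s : seq 'I_sigma) : seq 'I_sigma :=
  if s is x0 :: _ then [seq last x0 r | r <- bwt_matrix ord s] else [::].

Definition rank (sigma : nat) (L : seq 'I_sigma) (c : 'I_sigma) (j : nat) : nat :=
  count_mem c (take j L).

(* [reversed] is the known choice: [reversed y] tells which of pi and its
   reversal the order attached to y is. *)
Definition pm_ordering (sigma : nat) (ord : local_orders sigma)
    (pi : alpha_order sigma) (reversed : seq 'I_sigma -> bool) : Prop :=
  forall y, ord y = if reversed y then reversal pi else pi.

(* ** A word RAM

   Registers and memory cells hold w-bit words. The working memory consists of
   numbered arrays; the array is named in the program text and only the index
   into it is a word, so that a constant number of arrays of length O(n) can be
   addressed as soon as n < 2 ^ w. Programs are structured: a fixed program is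
   a fixed finite piece of syntax, it uses O(1) registers, and every
   instruction and every test costs one time unit. *)

Definition reg := nat.
Definition array := nat.

Inductive binop :=
  | Add | Sub | Mul | Div | Mod | And | Or | Xor | Shl | Shr | Eq | Lt.

Inductive instr :=
  | Const (x : reg) (k : nat)                (* x := k *)
  | Op (x : reg) (o : binop) (y z : reg)     (* x := y o z *)
  | Read (x : reg) (A : array) (y : reg)     (* x := A[y] *)
  | Write (A : array) (y x : reg)            (* A[y] := x *)
  | Access (x y : reg)                       (* x := L[y] *)
  | Rank (x c j : reg)                       (* x := rank_c(L, j) *)
  | Position (x c : reg)                     (* x := position of c in pi *)
  | Choice (x : reg) (A : array) (p l : reg).
    (* x := 1 if the order of the string y stored in A[p], ..., A[p + l - 1]
       is the reversal of pi, and x := 0 if it is pi *)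

Inductive cmd :=
  | Skip
  | Do (i : instr)
  | Seq (P Q : cmd)
  | If (x : reg) (P Q : cmd)
  | While (x : reg) (P : cmd).

Record state := State { regs : reg -> nat; mem : array -> nat -> nat }.

Definition word (w k : nat) : nat := k %% 2 ^ w.

(* Arithmetic is modulo 2 ^ w. *)
Definition eval_op (w : nat) (o : binop) (x y : nat) : nat :=
  word w match o with
  | Add => x + y
  | Sub => x + 2 ^ w - y
  | Mul => x * y
  | Div => x %/ y
  | Mod => x %% y
  | And => Nat.land x y
  | Or => Nat.lor x y
  | Xor => Nat.lxor x y
  | Shl => x * 2 ^ y
  | Shr => x %/ 2 ^ y
  | Eq => x == y
  | Lt => x < y
  end.

Definition set_reg (st : state) (x : reg) (v : nat) : state :=
  State (fun x' => if x' == x then v else regs st x') (mem st).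

Definition set_mem (st : state) (A : array) (k v : nat) : state :=
  State (regs st)
        (fun A' k' => if (A' == A) && (k' == k) then v else mem st A' k').

Definition string_of_words (sigma : nat) (ws : seq nat) : option (seq 'I_sigma) :=
  if all (fun a => a < sigma) ws then Some (pmap insub ws) else None.

(* What the machine is given besides its registers: the transformed string,
   pi, and the choice function. None of it is writable. *)
Record input (sigma : nat) := Input {
  in_bwt : seq 'I_sigma;
  in_pi : alpha_order sigma;
  in_reversed : seq 'I_sigma -> bool }.

(* [lens] lists the lengths of the allocated arrays; array A has length
   [nth 0 lens A]. The result is [None] on an access outside the allocated
   memory, outside L, or with a word that does not encode a symbol. *)
Definition eval_instr (w sigma : nat) (I : input sigma) (lens : seq nat)
    (st : state) (i : instr) : option state :=
  let r := regs st in
  match i with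
  | Const x k => Some (set_reg st x (word w k))
  | Op x o y z => Some (set_reg st x (eval_op w o (r y) (r z)))
  | Read x A y =>
      if r y < nth 0 lens A then Some (set_reg st x (mem st A (r y))) else None
  | Write A y x =>
      if r y < nth 0 lens A then Some (set_mem st A (r y) (r x)) else None
  | Access x y =>
      omap (fun a : 'I_sigma => set_reg st x a) (onth (in_bwt I) (r y))
  | Rank x c j =>
      if r j <= size (in_bwt I) then
        omap (fun a : 'I_sigma => set_reg st x (rank (in_bwt I) a (r j)))
             (insub (r c))
      else None
  | Position x c =>
      omap (fun a : 'I_sigma => set_reg st x (in_pi I a)) (insub (r c))
  | Choice x A p l =>
      if r p + r l <= nth 0 lens A then
        omap (fun y => set_reg st x (in_reversed I y))
             (string_of_words sigma [seq mem st A k | k <- iota (r p) (r l)])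
      else None
  end.

(* [exec w I lens P st t st']: started in st, P halts after t steps in st'. *)
Inductive exec (w sigma : nat) (I : input sigma) (lens : seq nat) :
    cmd -> state -> nat -> state -> Prop :=
  | exec_skip st : exec w I lens Skip st 0 st
  | exec_do i st st' :
      eval_instr w I lens st i = Some st' ->
      exec w I lens (Do i) st 1 st'
  | exec_seq P Q st1 st2 st3 t1 t2 :
      exec w I lens P st1 t1 st2 -> exec w I lens Q st2 t2 st3 ->
      exec w I lens (Seq P Q) st1 (t1 + t2) st3
  | exec_if_true x P Q st st' t :
      regs st x != 0 -> exec w I lens P st t st' ->
      exec w I lens (If x P Q) st t.+1 st'
  | exec_if_false x P Q st st' t :
      regs st x = 0 -> exec w I lens Q st t st' ->
      exec w I lens (If x P Q) st t.+1 st'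
  | exec_while_true x P st1 st2 st3 t1 t2 :
      regs st1 x != 0 -> exec w I lens P st1 t1 st2 ->
      exec w I lens (While x P) st2 t2 st3 ->
      exec w I lens (While x P) st1 (t1 + t2).+1 st3
  | exec_while_false x P st :
      regs st x = 0 -> exec w I lens (While x P) st 1 st.

Lemma exec_det (w sigma : nat) (I : input sigma) (lens : seq nat) (P : cmd)
    (st : state) (t1 t2 : nat) (st1 st2 : state) :
  exec w I lens P st t1 st1 -> exec w I lens P st t2 st2 ->
  t1 = t2 /\ st1 = st2.
Proof.
move=> H1; elim: H1 t2 st2 => {P st t1 st1}.
- by move=> st t2 st2 H; inversion H.
- by move=> i st st' e t2 st2 H; inversion H as [|? ? ? e'| | | | |]; move: e'; rewrite e => -[].
- move=> P Q a b d t1 t2 _ IH1 _ IH2 t st H.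
  inversion H as [| |? ? ? ? ? ? ? E1 E2| | | |]; subst.
  have [-> eb] := IH1 _ _ E1; rewrite -eb in E2.
  by have [-> ->] := IH2 _ _ E2.
- move=> x P Q st st' t nz _ IH t2 st2 H.
  inversion H as [| | |? ? ? ? ? ? _ E|? ? ? ? ? ? z _| |]; subst.
    by have [-> ->] := IH _ _ E.
  by rewrite z in nz.
- move=> x P Q st st' t z _ IH t2 st2 H.
  inversion H as [| | |? ? ? ? ? ? nz _|? ? ? ? ? ? _ E| |]; subst.
    by rewrite z in nz.
  by have [-> ->] := IH _ _ E.
- move=> x P a b d t1 t2 nz _ IH1 _ IH2 t st H.
  inversion H as [| | | | |? ? ? ? ? ? ? _ E1 E2|? ? ? z]; subst.
    have [-> eb] := IH1 _ _ E1; rewrite -eb in E2.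
    by have [-> ->] := IH2 _ _ E2.
  by rewrite z in nz.
- move=> x P st z t st' H.
  inversion H as [| | | | |? ? ? ? ? ? ? nz _ _|]; subst => //.
  by rewrite z in nz.
Qed.

(* Register 0 holds the length of the string and register 1 the index of the
   row (rows and string positions are numbered from 0). *)
Definition init (n i : nat) : state :=
  State (fun x => if x == 0 then n else if x == 1 then i else 0) (fun _ _ => 0).

(* The result is read off cells 0, ..., n - 1 of array 0. *)
Definition output (n : nat) (st : state) : seq nat :=
  [seq mem st 0 k | k <- iota 0 n].

(* From the given input, P writes s in at most [time] steps, using at most
   [space] words of working memory (output included). *)
Definition retrieves (w sigma : nat) (I : input sigma) (i : nat) (P : cmd)
    (s : seq 'I_sigma) (time space : nat) : Prop :=
  exists (lens : seq nat) (t : nat) (st : state),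
    [/\ exec w I lens P (init (size s) i) t st,
        output (size s) st = [seq val a | a <- s],
        t <= time & sumn lens <= space].

(* Main.v *)
Require Import Defs.
From mathcomp Require Import all_boot all_fingroup zify.

(* The rows prefixed by a string y form an interval [lower y, upper y), and
   moving the last letter to the front matches the rows of y that end in c with
   the rows of cy. If y and cy carry the same order, the rows of cyd (d a letter)
   are preceded inside cy by as many rows as there are c's in L between lower y
   and lower (yd); if they carry opposite orders, by as many as there are c's
   between upper (yd) and upper y. So the interval of cyd follows from those of
   y, yd and cy with O(1) rank queries, and keeping the intervals of all the
   suffixes of the known prefix s[0 .. j) lets them all be extended by the letter
   s[j] in O(j) time and O(n) space.

   To find s[j], start from row i and drop the letters of s[0 .. j) one by one:
   the r-th row of cy is followed by the same letter as the row of y holding the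
   r-th c of L inside y, counted from the top or from the bottom according to
   whether the orders agree. A select table makes each step O(1), and the last
   row reached begins with s[j]. *)

Set Implicit Arguments.
Unset Strict Implicit.
Unset Printing Implicit Defensive.

(** * Ranges of rows and rank queries *)

Section SortedCount.

Variable T : Type.
Implicit Types (f : T -> nat) (xs : seq T).

Lemma sorted_leq_filter f v xs : sorted leq (map f xs) ->
  take (count (fun x => f x < v) xs) xs = filter (fun x => f x < v) xs.
Proof.
elim: xs => //= x xs IH srt; case: ltnP => [ltxv | lexv] /=.
  by rewrite IH // (path_sorted srt).
have none : filter (fun x => f x < v) xs = [::].
  apply/nilP; rewrite /nilp size_filter -leqn0 leqNgt -has_count -all_predC.
  move: srt; rewrite (path_sortedE leq_trans) all_map => /andP[ge_x _].
  by apply: sub_all ge_x => t /= /(leq_trans lexv); rewrite leqNgt.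
by rewrite -size_filter none take0.
Qed.

Lemma sorted_nth_ltn f v xs x0 p : sorted leq (map f xs) -> p < size xs ->
  (f (nth x0 xs p) < v) = (p < count (fun x => f x < v) xs).
Proof.
move=> srt ltp.
have leq_nth q r : q <= r -> r < size xs -> f (nth x0 xs q) <= f (nth x0 xs r).
  move=> leqr ltr; have ltq := leq_ltn_trans leqr ltr.
  have := sorted_leq_nth leq_trans leqnn 0 srt; rewrite size_map => /(_ q r).
  by rewrite !inE ltq ltr !(nth_map x0) //; apply.
have e := sorted_leq_filter v srt.
set m := count _ _ in e *.
have lem : m <= size xs by apply: count_size.
case: (ltnP p m) => [ltpm | lemp].
  rewrite -(nth_take x0 ltpm) e.
  have : p < size (filter (fun x => f x < v) xs) by rewrite size_filter.
  have := filter_all (fun x => f x < v) xs.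
  by move=> /(all_nthP x0) /[apply].
apply/negP => ltv.
(* Otherwise the first [p.+1] entries would all lie below [v], while only [m <= p] entries do. *)
have : all (fun x => f x < v) (take p.+1 xs).
  apply/(all_nthP x0) => q; rewrite size_takel // => ltq.
  by rewrite nth_take //; apply: leq_ltn_trans ltv; apply: leq_nth.
rewrite all_count size_takel // => /eqP cE.
have := count_cat (fun x => f x < v) (take p.+1 xs) (drop p.+1 xs).
rewrite cat_take_drop cE -/m; lia.
Qed.

End SortedCount.

(** Adding the booleans as numbers makes one hypothesis say both that [P1] and [P2] are disjoint and
    that they cover [P]. *)
Lemma count_split (T : eqType) (P P1 P2 : pred T) (l : seq T) :
  {in l, forall x, P x = P1 x + P2 x :> nat} -> count P l = count P1 l + count P2 l.
Proof.
elim: l => //= x l IH e; rewrite IH.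
  by rewrite e ?mem_head //; lia.
by move=> z lz; apply: e; rewrite in_cons lz orbT.
Qed.

(** * Rank and select on a fixed string *)

Section Rank.

Variables (sigma : nat) (L : seq 'I_sigma) (c : 'I_sigma).

Lemma leq_rank p q : p <= q -> rank L c p <= rank L c q.
Proof.
move=> lepq; rewrite /rank -(cat_take_drop p (take q L)) take_takel //.
by rewrite count_cat leq_addr.
Qed.

Lemma rank_le_count p : rank L c p <= count_mem c L.
Proof. by rewrite /rank -{2}(cat_take_drop p L) count_cat leq_addr. Qed.

Lemma rankS x0 q : q < size L -> nth x0 L q = c -> rank L c q.+1 = (rank L c q).+1.
Proof.
move=> ltq qc; rewrite /rank (take_nth x0 ltq) -cats1 count_cat /= qc eqxx.
by rewrite addn0 addn1.
Qed.

Lemma rank_size : rank L c (size L) = count_mem c L.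
Proof. by rewrite /rank take_size. Qed.

Lemma select_exists x0 r : r < count_mem c L ->
  exists q, [/\ q < size L, nth x0 L q = c & rank L c q = r].
Proof.
rewrite /rank; elim: L r => //= a l IH r.
have [->|neq] := eqVneq a c; last first.
  rewrite add0n => /IH[q [ltq qc cr]]; exists q.+1; split => //=.
  by rewrite (negPf neq).
case: r => [_|r]; first by exists 0.
rewrite add1n ltnS => /IH[q [ltq qc cr]]; exists q.+1; split => //=.
by rewrite eqxx cr.
Qed.

(** [rank L c] jumps right after [q], so by monotonicity bounds on ranks become bounds on positions.
    This turns a selected occurrence back into a row of a given interval. *)
Lemma rank_between x0 q a b :
  q < size L -> nth x0 L q = c -> rank L c a <= rank L c q < rank L c b -> a <= q < b.
Proof.
move=> ltq qc /andP[lea ltb]; apply/andP; split; rewrite leqNgt; apply/negP.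
  by move=> /leq_rank; rewrite (rankS ltq qc); lia.
by rewrite ltnS => /leq_rank; lia.
Qed.

End Rank.

(** * Rows with a common prefix: their intervals and recurrences *)

Section Matrix.

Variables (sigma : nat) (ord : local_orders sigma).
Implicit Types (a b c d : 'I_sigma) (x y u v r : seq 'I_sigma).

(* The side of the string [y] on which the row [u] falls, the prefix [x] of
   both being already read: 0 before, 1 if [y] is a prefix of [u], 2 after. *)
Fixpoint side_from x y u : nat :=
  match y, u with
  | a :: y', b :: u' =>
      if b == a then side_from (rcons x a) y' u'
      else if precedes (ord x) b a then 0 else 2
  | _, _ => 1
  end.

Definition side y u := side_from [::] y u.

Lemma side_from_le2 x y u : side_from x y u <= 2.
Proof.
elim: y u x => [|a y IH] [|b u] x //=.
by case: eqP => // _; case: ifP.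
Qed.

(** Where [u] and [v] first differ, either both have already left [y] on the same side, or a single
    local order compares both letters with that of [y] and transitivity concludes. Hence a sorted
    matrix meets the three sides of [y] one after the other. *)
Lemma row_le_side_from x y u v : size u = size v -> size y <= size u ->
  row_le_from ord x u v -> side_from x y u <= side_from x y v.
Proof.
elim: y u v x => [|a y IH] [|b u] [|b' v] x //= [sz_uv] sz_y.
have [<-|neq] := eqVneq b b'.
  by case: eqP => // <-; apply: IH.
move=> lt_bb'; have [eba|nba] := eqVneq b a; have [eb'a|nb'a] := eqVneq b' a.
- by rewrite eba eb'a eqxx in neq.
- rewrite -eba (_ : precedes _ b' b = false) ?side_from_le2 //.
  by move: lt_bb'; rewrite /precedes; case: ltngtP.
- by rewrite -eb'a lt_bb'.
case: ifP => // nlt; rewrite ifF //; apply: contraFF nlt.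
by move: lt_bb'; rewrite /precedes; apply: ltn_trans.
Qed.

(** One more letter moves only the strings that begin with [y], and the order attached to [y]
    decides where they go. *)
Lemma side_rcons (x0 : 'I_sigma) y d u : size y < size u ->
  side (rcons y d) u =
    if side y u == 1 then
      if nth x0 u (size y) == d then 1
      else if precedes (ord y) (nth x0 u (size y)) d then 0 else 2
    else side y u.
Proof.
rewrite /side -[y in ord y]cat0s; elim: y u [::] => [|a y IH] [|b u] x //= ltyu.
  by rewrite cats0; case: u ltyu.
have [eba|nba] := eqVneq b a; first by rewrite IH // cat_rcons.
by case: ifP.
Qed.

Lemma side_prefix y u : size y <= size u -> (side y u == 1) = (take (size y) u == y).
Proof.
rewrite /side; elim: y u [::] => [|a y IH] [|b u] x //= ley.
rewrite eqseq_cons; have [eba|nba] := eqVneq b a; first by rewrite IH.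
by case: ifP.
Qed.

Variable s : seq 'I_sigma.
Let n := size s.
Let M := bwt_matrix ord s.
Let L := bwt ord s.

(** Counting gives every [y] of length at most [n] an interval [[lower y, upper y)], empty when no
    row begins with [y]. *)
Definition lower y := count (fun r => side y r < 1) M.
Definition upper y := count (fun r => side y r < 2) M.

Lemma size_rotations : size (rotations s) = n.
Proof. by rewrite size_map size_iota. Qed.

Lemma size_bwt_matrix : size M = n.
Proof. by rewrite size_sort size_rotations. Qed.

Lemma size_row r : r \in M -> size r = n.
Proof. by rewrite mem_sort => /mapP[k _ ->]; rewrite size_rot. Qed.

Lemma count_matrix (P : pred (seq 'I_sigma)) : count P M = count P (rotations s).
Proof. by apply/seq.permP; rewrite perm_sort. Qed.

Lemma size_bwt : size L = n.
Proof.
rewrite /L /bwt; case E: s => [|a l]; first by rewrite /n E.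
by rewrite size_map -E size_bwt_matrix.
Qed.

Lemma bwtE (x0 : 'I_sigma) : L = [seq last x0 r | r <- M].
Proof.
rewrite /L /M /bwt; case E: s => [|a l]; first by [].
apply/eq_in_map => r; rewrite -E => /size_row; rewrite /n E.
by case: r.
Qed.

Lemma sorted_side y : size y <= n -> sorted leq (map (side y) M).
Proof.
move=> ley; rewrite sorted_map.
apply: (@sub_in_sorted _ (mem M) (row_le ord)); last exact/sort_sorted/row_le_total.
  move=> u v /size_row su /size_row sv; apply: row_le_side_from.
    by rewrite su sv.
  by rewrite su.
exact/allP.
Qed.

Lemma nth_side_lt y p : size y <= n -> p < n ->
  (side y (nth [::] M p) < 1) = (p < lower y)
  /\ (side y (nth [::] M p) < 2) = (p < upper y).
Proof.
by move=> ley ltp; split; apply: sorted_nth_ltn; rewrite ?size_bwt_matrix ?sorted_side.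
Qed.

Lemma row_in_range y p : size y <= n -> p < n ->
  (lower y <= p < upper y) = (take (size y) (nth [::] M p) == y).
Proof.
move=> ley ltp; have [lo up] := nth_side_lt ley ltp.
rewrite -side_prefix.
  by rewrite leqNgt -lo -up; case: side => [|[|]].
by rewrite (@size_row (nth _ _ _)) ?mem_nth ?size_bwt_matrix.
Qed.

(** The rows before the interval of [y] are the first [lower y] rows, so a rank query at that point
    counts those among them that end in [c]. *)
Lemma rank_lower (x0 : 'I_sigma) y c : size y <= n ->
  rank L c (lower y) = count (fun r => (last x0 r == c) && (side y r < 1)) M.
Proof.
move=> ley; rewrite /rank (bwtE x0) -map_take sorted_leq_filter ?sorted_side //.
by rewrite count_map count_filter; apply: eq_count => r /=.
Qed.

Lemma rank_upper (x0 : 'I_sigma) y c : size y <= n ->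
  rank L c (upper y) = count (fun r => (last x0 r == c) && (side y r < 2)) M.
Proof.
move=> ley; rewrite /rank (bwtE x0) -map_take sorted_leq_filter ?sorted_side //.
by rewrite count_map count_filter; apply: eq_count => r /=.
Qed.

Lemma upper_le y : upper y <= n.
Proof. by rewrite -size_bwt_matrix count_size. Qed.

Lemma lower_le_upper y : lower y <= upper y.
Proof. by apply: sub_count => r /=; case: side. Qed.

Lemma lower_nil : lower [::] = 0.
Proof. by rewrite /lower (eq_count (a2 := pred0)) ?count_pred0 // => -[]. Qed.

Lemma upper_nil : upper [::] = n.
Proof.
rewrite /upper (eq_count (a2 := predT)) ?count_predT ?size_bwt_matrix //.
Qed.

(** Each rotation becomes the next one in the list, and the last one comes back to [s]. *)
Lemma map_rot_rotations : map (rot 1) (rotations s) = rot 1 (rotations s).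
Proof.
rewrite /rotations -map_comp -/n; case E: n => [|m] //.
rewrite [in RHS]/= rot1_cons (iotaDl 1 0) -map_comp.
rewrite -[in LHS](addn1 m) iotaD map_cat cats1 add0n /=; congr rcons.
  apply/eq_in_map => k; rewrite mem_iota /= => ltk.
  by rewrite -rotD -/n ?E // add1n; lia.
by rewrite -rotD -/n ?E // add1n rot0 rot_oversize // -/n E.
Qed.

(** Moving the first letter to the end permutes the rows; every correspondence between rows
    beginning with [c] and rows ending in [c] rests on this invariance. *)
Lemma count_rot1 (P : pred (seq 'I_sigma)) : count P M = count (fun r => P (rot 1 r)) M.
Proof.
rewrite !count_matrix -[RHS](count_map (rot 1) P) map_rot_rotations.
by apply/seq.permP; rewrite perm_sym perm_rot.
Qed.

(** The rotation of a row of [cy] is a row of [y] that ends in [c] and continues alike. The length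
    bound keeps the letter read after [y] distinct from the final [c]. *)
Lemma count_extend (x0 : 'I_sigma) c y (Q : pred 'I_sigma) : (size y).+1 < n ->
  count (fun r => [&& last x0 r == c, side y r == 1 & Q (nth x0 r (size y))]) M
  = count (fun r => (side (c :: y) r == 1) && Q (nth x0 r (size y).+1)) M.
Proof.
move=> lty; rewrite count_rot1; apply: eq_in_count => r /size_row szr.
rewrite !side_prefix ?size_rot /= ?szr; try lia.
case: r szr => [|a u] /= szr; first by rewrite -szr in lty.
rewrite /rot /= drop0 take0 last_cat /= eqseq_cons nth_cat takel_cat; last by lia.
by rewrite (_ : size y < size u) ?andbA // -ltnS szr.
Qed.

Lemma count_extend0 (x0 : 'I_sigma) c y : size y < n ->
  count (fun r => (last x0 r == c) && (side y r == 1)) M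
  = count (fun r => side (c :: y) r == 1) M.
Proof.
move=> lty; rewrite count_rot1; apply: eq_in_count => r /size_row szr.
rewrite !side_prefix ?size_rot /= ?szr; try lia.
case: r szr => [|a u] /= szr; first by rewrite -szr in lty.
rewrite /rot /= drop0 take0 cats1 last_rcons eqseq_cons.
by rewrite -cats1 takel_cat //; lia.
Qed.

Lemma upperE y : upper y = lower y + count (fun r => side y r == 1) M.
Proof.
by apply: count_split => r _; case: (side y r) => [|[|]].
Qed.

(** The interval of [cy] has as many rows as the interval of [y] has occurrences of [c] in [L]. Like
    the next recurrences it is stated additively, to avoid truncated subtraction. *)
Lemma upper_cons c y : size y < n ->
  upper (c :: y) + rank L c (lower y) = lower (c :: y) + rank L c (upper y).
Proof.
move=> lty; rewrite upperE -(count_extend0 c) // (rank_lower c) ?(rank_upper c); try lia.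
rewrite -addnA; congr addn; rewrite addnC; apply/esym/count_split => r _.
by case: (last _ _ == c) => //; case: (side y r) => [|[|]].
Qed.

Lemma lower_rcons (x0 : 'I_sigma) y d : size y < n ->
  lower (rcons y d) = lower y
    + count (fun r => (side y r == 1) && precedes (ord y) (nth x0 r (size y)) d) M.
Proof.
move=> lty; have e : {in M, forall r, (side (rcons y d) r < 1) = (side y r < 1) +
    ((side y r == 1) && precedes (ord y) (nth x0 r (size y)) d) :> nat}.
  move=> r /size_row szr; rewrite (side_rcons x0) ?szr //.
  case: (side y r) => [|[|]] //=; case: eqP => [-> | _]; last by case: ifP.
  by rewrite /precedes !ltnn.
exact: count_split.
Qed.

Lemma rank_lower_rcons (x0 : 'I_sigma) y d c : size y < n ->
  rank L c (lower (rcons y d)) = rank L c (lower y)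
    + count (fun r => [&& last x0 r == c, side y r == 1
                        & precedes (ord y) (nth x0 r (size y)) d]) M.
Proof.
move=> lty; rewrite !(rank_lower x0) ?size_rcons //; last exact: ltnW.
have e : {in M, forall r, (last x0 r == c) && (side (rcons y d) r < 1) =
    ((last x0 r == c) && (side y r < 1)) + [&& last x0 r == c, side y r == 1
                        & precedes (ord y) (nth x0 r (size y)) d] :> nat}.
  move=> r /size_row szr; rewrite (side_rcons x0) ?szr //; case: (last _ _ == c) => //=.
  case: (side y r) => [|[|]] //=; case: eqP => [-> | _]; last by case: ifP.
  by rewrite /precedes !ltnn.
exact: count_split.
Qed.

(** Mirror image of the previous count: the rows of [y] lying after those of [yd] are the ones whose
    next letter follows [d]. *)
Lemma rank_upper_rcons (x0 : 'I_sigma) y d c : size y < n ->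
  rank L c (upper y) = rank L c (upper (rcons y d))
    + count (fun r => [&& last x0 r == c, side y r == 1
                        & precedes (ord y) d (nth x0 r (size y))]) M.
Proof.
move=> lty; rewrite !(rank_upper x0) ?size_rcons //; last exact: ltnW.
have e : {in M, forall r, (last x0 r == c) && (side y r < 2) =
    ((last x0 r == c) && (side (rcons y d) r < 2)) + [&& last x0 r == c, side y r == 1
                        & precedes (ord y) d (nth x0 r (size y))] :> nat}.
  move=> r /size_row szr; rewrite (side_rcons x0) ?szr //; case: (last _ _ == c) => //=.
  case: (side y r) => [|[|]] //=; rewrite /precedes; case: eqP => [-> | /eqP neq].
    by rewrite ltnn.
  have: (ord y (nth x0 r (size y)) : nat) != ord y d.
    by rewrite (inj_eq val_inj) (inj_eq perm_inj).
  by case: (ltngtP (ord y (nth x0 r (size y))) (ord y d)).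
exact: count_split.
Qed.

(** Both sides count continuations by a letter preceding [d]: in [cy] directly, in [y] among the
    rows ending in [c]. [count_extend] identifies the two counts. *)
Lemma lower_cons_same c y d : (size y).+1 < n -> ord (c :: y) = ord y ->
  lower (c :: rcons y d) + rank L c (lower y)
  = lower (c :: y) + rank L c (lower (rcons y d)).
Proof.
move=> lty eo; rewrite -rcons_cons (lower_rcons c) // (rank_lower_rcons c); last exact: ltnW.
rewrite (count_extend c c (fun a => precedes (ord y) a d)) //= eo; lia.
Qed.

(** The letters preceding [d] after [cy] are those following [d] after [y], so the count is taken at
    the bottom of the interval of [y]. *)
Lemma lower_cons_opposite c y d : (size y).+1 < n ->
  (forall a b, precedes (ord (c :: y)) a b = precedes (ord y) b a) ->
  lower (c :: rcons y d) + rank L c (upper (rcons y d))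
  = lower (c :: y) + rank L c (upper y).
Proof.
move=> lty eo; rewrite -rcons_cons (lower_rcons c) //.
rewrite (@rank_upper_rcons c y d c); last exact: ltnW.
rewrite (count_extend c c (fun a => precedes (ord y) d a)) //=.
under eq_count do rewrite eo; lia.
Qed.

Lemma leq_lower_rcons y d : size y < n -> lower y <= lower (rcons y d).
Proof. by move=> lty; rewrite (lower_rcons d) // leq_addr. Qed.

(** By rotation the first column is a rearrangement of [L], so first letters can be counted in
    [L]. *)
Lemma lower1 d : 0 < n ->
  lower [:: d] = count (fun a => precedes (ord [::]) a d) L.
Proof.
move=> n0; rewrite -[[:: d]]/(rcons [::] d) (lower_rcons d) // lower_nil add0n.
rewrite (bwtE d) count_map [RHS]count_rot1; apply: eq_in_count => r /size_row szr.
case: r szr => [|a u] /= szr; first by rewrite -szr in n0.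
by rewrite /rot /= drop0 take0 cats1 last_rcons.
Qed.

Lemma upper1 d : 0 < n -> upper [:: d] = lower [:: d] + count_mem d L.
Proof.
move=> n0; have := @upper_cons d [::] n0.
rewrite lower_nil upper_nil -size_bwt rank_size /rank take0 /=; lia.
Qed.

End Matrix.

(** * Cumulative counts and the LF map *)

Section FirstColumn.

Variables (sigma : nat) (L : seq 'I_sigma) (pi : alpha_order sigma) (x0 : 'I_sigma).

(** The cumulative count of the LF map, always taken for [pi], even if the empty string carries the
    reversal. *)
Definition smaller (c : 'I_sigma) := count (fun a => pi a < pi c) L.

(* The select table is the inverse of this map. *)
Definition lf (q : nat) := smaller (nth x0 L q) + rank L (nth x0 L q) q.

Lemma smaller_count_le c : smaller c + count_mem c L <= size L.
Proof.
have := count_predC (fun a => pi a < pi c) L; rewrite -/(smaller c) => <-.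
by rewrite leq_add2l; apply: sub_count => a /= /eqP ->; rewrite ltnn.
Qed.

Lemma smaller_add_lt c d r :
  pi c < pi d -> r < count_mem c L -> smaller c + r < smaller d.
Proof.
move=> ltcd ltr; apply: (@leq_trans (smaller c + count_mem c L)).
  by rewrite ltn_add2l.
rewrite /smaller.
have -> : count (fun a => pi a < pi c) L + count_mem c L
    = count (fun a => pi a <= pi c) L.
  apply/esym/count_split => a _ /=.
  rewrite leq_eqVlt (inj_eq val_inj) (inj_eq perm_inj).
  by case: eqP => [-> | _]; rewrite ?ltnn /= ?addn0.
by apply: sub_count => a /= /leq_ltn_trans; apply.
Qed.

Lemma greater_count c :
  count (fun a => pi c < pi a) L + (smaller c + count_mem c L) = size L.
Proof.
rewrite -(count_predC (fun a => pi c < pi a)); congr addn; apply/esym/count_split => a _ /=.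
rewrite -leqNgt leq_eqVlt (inj_eq val_inj) (inj_eq perm_inj).
by case: eqP => [-> | _]; rewrite ?ltnn /= ?addn0.
Qed.

Lemma rank_lt_count q : q < size L ->
  rank L (nth x0 L q) q < count_mem (nth x0 L q) L.
Proof. by move=> ltq; rewrite -(rankS (x0 := x0)) // rank_le_count. Qed.

Lemma lf_lt q : q < size L -> lf q < size L.
Proof.
move=> ltq; rewrite /lf; have := rank_lt_count ltq.
have := smaller_count_le (nth x0 L q); lia.
Qed.

(** Distinct letters have disjoint blocks of values by [smaller_add_lt], and inside a block the rank
    increases strictly from one occurrence to the next. Hence no entry of the select table is
    overwritten. *)
Lemma lf_inj q r : q < size L -> r < size L -> lf q = lf r -> q = r.
Proof.
move=> ltq ltr; rewrite /lf; have kq := rank_lt_count ltq; have kr := rank_lt_count ltr.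
have [e | neq] := eqVneq (nth x0 L q) (nth x0 L r).
  have := rankS ltq e; have := rankS ltr (erefl (nth x0 L r)); rewrite e => er eq.
  case: (ltngtP q r) => // /(leq_rank L (nth x0 L r)); lia.
have: pi (nth x0 L q) != pi (nth x0 L r) by rewrite (inj_eq perm_inj).
rewrite -(inj_eq val_inj) neq_ltn => /orP[] /smaller_add_lt lt;
  [have := lt _ kq | have := lt _ kr]; lia.
Qed.

Lemma select_lf c r : r < count_mem c L ->
  exists q, [/\ q < size L, nth x0 L q = c, rank L c q = r & lf q = smaller c + r].
Proof. by move=> /(select_exists x0)[q [ltq qc qr]]; exists q; rewrite /lf qc qr. Qed.

End FirstColumn.

(** * Dropping the first letter of a known prefix *)

Section Descent.

Variables (sigma : nat) (ord : local_orders sigma) (s : seq 'I_sigma).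
Variables (c d : 'I_sigma) (y : seq 'I_sigma).
Hypothesis lty : (size y).+1 < size s.

Let L := bwt ord s.
Let lo := lower ord s.
Let up := upper ord s.

Let upper_cons_rcons :
  up (c :: rcons y d) + rank L c (lo (rcons y d))
  = lo (c :: rcons y d) + rank L c (up (rcons y d)).
Proof. by apply: upper_cons; rewrite size_rcons. Qed.

Let lower_lt : lo (c :: y) <= lo (c :: rcons y d).
Proof. by rewrite -rcons_cons; apply: leq_lower_rcons. Qed.

(** The offset of [p] in the interval of [cy] is carried over to the occurrences of [c] inside [y],
    counted from the top; the rank bounds say that the occurrence reached lies in the interval of
    [yd]. *)
Lemma descend_same p : ord (c :: y) = ord y ->
  lo (c :: rcons y d) <= p < up (c :: rcons y d) ->
  lo (c :: y) <= p /\
  rank L c (lo (rcons y d)) <= rank L c (lo y) + (p - lo (c :: y))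
    < rank L c (up (rcons y d)).
Proof.
move=> eo; have := lower_cons_same d lty eo; move: upper_cons_rcons lower_lt.
rewrite /lo /up /L; lia.
Qed.

(** Here the offset is counted from the bottom, where the last occurrence of [c] inside [y] has rank
    [rank L c (up y) - 1]. The second conjunct keeps the subtractions from truncating. *)
Lemma descend_opposite p :
  (forall a b, precedes (ord (c :: y)) a b = precedes (ord y) b a) ->
  lo (c :: rcons y d) <= p < up (c :: rcons y d) ->
  [/\ lo (c :: y) <= p, p - lo (c :: y) < rank L c (up y) &
  rank L c (lo (rcons y d)) <= rank L c (up y) - 1 - (p - lo (c :: y))
    < rank L c (up (rcons y d))].
Proof.
move=> eo; have := lower_cons_opposite d lty eo; move: upper_cons_rcons lower_lt.
rewrite /lo /up /L; split; lia.
Qed.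

End Descent.

(** * Half-open substrings *)

Section Slices.

Variables (T : Type) (x0 : T) (s : seq T).

Definition slice k j := take (j - k) (drop k s).

Lemma size_slice k j : j <= size s -> size (slice k j) = j - k.
Proof. by move=> lej; rewrite /slice size_takel // size_drop leq_sub2r. Qed.

Lemma slice_nil k : slice k k = [::].
Proof. by rewrite /slice subnn take0. Qed.

Lemma slice_cons k j : k < j -> j <= size s -> slice k j = nth x0 s k :: slice k.+1 j.
Proof.
move=> ltkj lej; rewrite /slice (drop_nth x0) ?(leq_trans ltkj) //.
by rewrite -{1}(subnSK ltkj).
Qed.

Lemma slice_rcons k j : k <= j -> j < size s -> slice k j.+1 = rcons (slice k j) (nth x0 s j).
Proof.
move=> lekj ltj; rewrite /slice subSn // (take_nth x0) ?size_drop ?ltn_sub2r //; last lia.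
by rewrite nth_drop subnKC.
Qed.

End Slices.

(** * Total correctness with running time *)

Section Machine.

Variables (w sigma : nat) (I : input sigma) (lens : seq nat).

(** [T] is only an upper bound on the time, so branches of unequal length can share it. *)
Definition runs (P : cmd) (st : state) (T : nat) (Q : state -> Prop) : Prop :=
  exists t st', [/\ exec w I lens P st t st', t <= T & Q st'].

Lemma runs_weaken P st T T' (Q Q' : state -> Prop) :
  T <= T' -> (forall st', Q st' -> Q' st') -> runs P st T Q -> runs P st T' Q'.
Proof.
move=> leT QQ' [t [st' [ex let_ Qst']]]; exists t, st'; split; auto.
exact: leq_trans leT.
Qed.

Lemma runs_skip st T (Q : state -> Prop) : Q st -> runs Skip st T Q.
Proof. by exists 0, st; split => //; constructor. Qed.

Lemma runs_seq P1 P2 st T1 T2 Q :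
  runs P1 st T1 (fun st' => runs P2 st' T2 Q) -> runs (Seq P1 P2) st (T1 + T2) Q.
Proof.
move=> [t1 [st1 [ex1 le1 [t2 [st2 [ex2 le2 Q2]]]]]].
by exists (t1 + t2), st2; split => //; [apply: exec_seq ex1 ex2 | apply: leq_add].
Qed.

Lemma runs_instr i P st st' T Q : eval_instr w I lens st i = Some st' ->
  runs P st' T Q -> runs (Seq (Do i) P) st T.+1 Q.
Proof.
move=> ev run; rewrite -add1n; apply: runs_seq.
by exists 1, st'; split => //; apply: exec_do.
Qed.

Lemma runs_if x (b : bool) P1 P2 st T Q : regs st x = b ->
  (b -> runs P1 st T Q) -> (~~ b -> runs P2 st T Q) -> runs (If x P1 P2) st T.+1 Q.
Proof.
case: b => xb H1 H2.
  have [t [st' [ex le Qst']]] := H1 isT.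
  by exists t.+1, st'; split => //; apply: exec_if_true; rewrite ?xb.
have [t [st' [ex le Qst']]] := H2 isT.
by exists t.+1, st'; split => //; apply: exec_if_false.
Qed.

Lemma runs_then P1 P2 st T1 T2 T R Q : runs P1 st T1 R -> T1 + T2 <= T ->
  (forall st', R st' -> runs P2 st' T2 Q) -> runs (Seq P1 P2) st T Q.
Proof.
move=> run1 leT run2; apply: (runs_weaken leT (Q := Q)) => //.
by apply/runs_seq/(runs_weaken _ run2 run1).
Qed.

(** The loop makes exactly [N] rounds, each a test and a body; the strict inequality pays for the
    final failing test. *)
Lemma runs_while x P (Inv : nat -> state -> Prop) N T st T' (Q : state -> Prop) :
  Inv 0 st ->
  (forall k st', k < N -> Inv k st' -> regs st' x != 0 /\ runs P st' T (Inv k.+1)) ->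
  (forall st', Inv N st' -> regs st' x = 0 /\ Q st') ->
  N * T.+1 < T' -> runs (While x P) st T' Q.
Proof.
move=> inv0 step stop leT.
suff main m : forall k st', k + m = N -> Inv k st' ->
    runs (While x P) st' (m * T.+1).+1 Q.
  exact: runs_weaken leT _ (main N 0 st _ inv0).
elim: m => [|m IH] k st'.
  rewrite addn0 => -> /stop[z Qst']; exists 1, st'; split => //.
  exact: exec_while_false.
move=> km invk; have [|nz [t1 [st1 [ex1 le1 inv1]]]] := step k st' _ invk; first by lia.
have [|t2 [st2 [ex2 le2 inv2]]] := IH k.+1 st1 _ inv1; first by lia.
exists (t1 + t2).+1, st2; split => //; first exact: exec_while_true ex2.
by rewrite mulSn; lia.
Qed.

Lemma regs_set_same st x v : regs (set_reg st x v) x = v.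
Proof. by rewrite /= eqxx. Qed.

Lemma regs_set_other st x y v a :
  (y == x) = false -> regs st y = a -> regs (set_reg st x v) y = a.
Proof. by move=> /= ->. Qed.

Lemma regs_set_mem st A k v y a : regs st y = a -> regs (set_mem st A k v) y = a.
Proof. by []. Qed.

(** A frame condition on registers only; the contents of memory are tracked separately. *)
Definition preserved (tmp : seq reg) (st st' : state) :=
  forall x, x \notin tmp -> regs st' x = regs st x.

Lemma preserved_refl tmp st : preserved tmp st st.
Proof. by []. Qed.

Lemma preserved_set_reg tmp st st' x v :
  x \in tmp -> preserved tmp st st' -> preserved tmp st (set_reg st' x v).
Proof.
move=> xt pr y yt; rewrite /= ifF ?pr //.
by apply/negbTE; apply: contraNneq yt => ->.
Qed.

Lemma preserved_set_mem tmp st st' A k v :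
  preserved tmp st st' -> preserved tmp st (set_mem st' A k v).
Proof. by []. Qed.

Lemma preserved_trans tmp tmp' st st' st'' :
  all [in tmp] tmp' -> preserved tmp st st' -> preserved tmp' st' st'' ->
  preserved tmp st st''.
Proof.
move=> /allP sub pr pr' x xt; rewrite pr' ?pr //.
by apply: contra xt; apply: sub.
Qed.

Lemma word_id k : k < 2 ^ w -> word w k = k.
Proof. exact: modn_small. Qed.

Lemma word_bool (b : bool) : 0 < w -> word w b = b.
Proof.
move=> w0; apply: word_id; apply: leq_ltn_trans (ltn_expl w (ltnSn 1)).
exact: leq_trans (leq_b1 b) w0.
Qed.

Section Instructions.

Variables (P : cmd) (st : state) (T : nat) (Q : state -> Prop).

Lemma runs_const x k : k < 2 ^ w ->
  runs P (set_reg st x k) T Q -> runs (Seq (Do (Const x k)) P) st T.+1 Q.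
Proof. by move=> kw; apply: runs_instr; rewrite /= word_id. Qed.

Lemma runs_add x y z a b : regs st y = a -> regs st z = b -> a + b < 2 ^ w ->
  runs P (set_reg st x (a + b)) T Q -> runs (Seq (Do (Op x Add y z)) P) st T.+1 Q.
Proof. by move=> ya zb abw; apply: runs_instr; rewrite /= ya zb /eval_op word_id. Qed.

(** The machine adds [2 ^ w] before subtracting; as [b <= a], reduction removes exactly that
    term. *)
Lemma runs_sub x y z a b : regs st y = a -> regs st z = b -> b <= a -> a < 2 ^ w ->
  runs P (set_reg st x (a - b)) T Q -> runs (Seq (Do (Op x Defs.Sub y z)) P) st T.+1 Q.
Proof.
move=> ya zb leba aw; apply: runs_instr; rewrite /= ya zb /eval_op /word.
by rewrite addnC -addnBA // modnDl modn_small //; lia.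
Qed.

Lemma runs_lt x y z a b : 0 < w -> regs st y = a -> regs st z = b ->
  runs P (set_reg st x (a < b)) T Q -> runs (Seq (Do (Op x Lt y z)) P) st T.+1 Q.
Proof. by move=> w0 ya zb; apply: runs_instr; rewrite /= ya zb /eval_op word_bool. Qed.

Lemma runs_eq x y z a b : 0 < w -> regs st y = a -> regs st z = b ->
  runs P (set_reg st x (a == b)) T Q -> runs (Seq (Do (Op x Eq y z)) P) st T.+1 Q.
Proof. by move=> w0 ya zb; apply: runs_instr; rewrite /= ya zb /eval_op word_bool. Qed.

Lemma runs_read x A y a v : regs st y = a -> a < nth 0 lens A -> Defs.mem st A a = v ->
  runs P (set_reg st x v) T Q -> runs (Seq (Do (Read x A y)) P) st T.+1 Q.
Proof. by move=> ya la mv; apply: runs_instr; rewrite /= ya la mv. Qed.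

Lemma runs_write A y x a v : regs st y = a -> regs st x = v -> a < nth 0 lens A ->
  runs P (set_mem st A a v) T Q -> runs (Seq (Do (Write A y x)) P) st T.+1 Q.
Proof. by move=> ya xv la; apply: runs_instr; rewrite /= ya xv la. Qed.

Lemma runs_access x y x0 a : regs st y = a -> a < size (in_bwt I) ->
  runs P (set_reg st x (nth x0 (in_bwt I) a)) T Q ->
  runs (Seq (Do (Access x y)) P) st T.+1 Q.
Proof. by move=> ya la; apply: runs_instr; rewrite /= ya onthE (nth_map x0). Qed.

Lemma runs_rank x c j (a : 'I_sigma) b : regs st c = a -> regs st j = b ->
  b <= size (in_bwt I) ->
  runs P (set_reg st x (rank (in_bwt I) a b)) T Q ->
  runs (Seq (Do (Rank x c j)) P) st T.+1 Q.
Proof. by move=> ca jb lb; apply: runs_instr; rewrite /= ca jb lb valK. Qed.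

Lemma runs_position x c (a : 'I_sigma) : regs st c = a ->
  runs P (set_reg st x (in_pi I a)) T Q ->
  runs (Seq (Do (Position x c)) P) st T.+1 Q.
Proof. by move=> ca; apply: runs_instr; rewrite /= ca valK. Qed.

Lemma runs_choice x A p l a b (y : seq 'I_sigma) :
  regs st p = a -> regs st l = b -> a + b <= nth 0 lens A ->
  [seq Defs.mem st A k | k <- iota a b] = [seq val c | c <- y] ->
  runs P (set_reg st x (in_reversed I y)) T Q ->
  runs (Seq (Do (Defs.Choice x A p l)) P) st T.+1 Q.
Proof.
move=> pa lb len_ok ey; apply: runs_instr; rewrite /= pa lb len_ok ey /string_of_words.
rewrite (_ : all _ _) /=; last by rewrite all_map; apply/allP => c _ /=.
by rewrite (_ : pmap insub _ = y) //; elim: y {ey} => //= c y ->; rewrite valK.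
Qed.

End Instructions.

End Machine.

(** * The inversion program *)

Local Notation "i ;; P" := (Seq (Do i) P) (at level 70, right associativity).

Local Notation rn := 0 (only parsing).
Local Notation ri := 1 (only parsing).
Local Notation rone := 2 (only parsing).
Local Notation rzero := 3 (only parsing).
Local Notation rj := 4 (only parsing).
Local Notation rt := 5 (only parsing).
Local Notation rc := 6 (only parsing).
Local Notation rpc := 7 (only parsing).
Local Notation ra := 8 (only parsing).
Local Notation rm := 9 (only parsing).
Local Notation ru := 10 (only parsing).
Local Notation rv := 11 (only parsing).
Local Notation rq := 12 (only parsing).
Local Notation rr := 13 (only parsing).
Local Notation rk := 14 (only parsing).
Local Notation rp := 15 (only parsing).
Local Notation rk1 := 16 (only parsing).
Local Notation rl := 17 (only parsing).
Local Notation rf := 18 (only parsing).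
Local Notation rg := 19 (only parsing).
Local Notation rb := 20 (only parsing).
Local Notation re := 21 (only parsing).
Local Notation ro := 22 (only parsing).
Local Notation rob := 23 (only parsing).
Local Notation roe := 24 (only parsing).
Local Notation rx := 25 (only parsing).
Local Notation ry := 26 (only parsing).
Local Notation rz := 27 (only parsing).

(* The output, the select table, and for each known letter s[k] the number of
   symbols of L that precede it in pi and the interval of s[k .. j). *)
Local Notation aS := 0 (only parsing).
Local Notation aSel := 1 (only parsing).
Local Notation aC := 2 (only parsing).
Local Notation aLo := 3 (only parsing).
Local Notation aUp := 4 (only parsing).

(** A linear scan for each request: it fits the quadratic time bound and avoids a table indexed by
    letters, since [sigma] may exceed [n]. *)
Definition count_smaller : cmd :=
  Position rpc rc ;; Const ra 0 ;; Const rm 0 ;; Op ru Lt rm rn ;;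
  While ru
    (Access rv rm ;; Position rv rv ;; Op rv Lt rv rpc ;; Op ra Add ra rv ;;
     Op rm Add rm rone ;; Op ru Lt rm rn ;; Skip).

Definition build_select : cmd :=
  Const rq 0 ;; Op rt Lt rq rn ;;
  While rt
    (Access rc rq ;;
     Seq count_smaller
       (Rank rr rc rq ;; Op rr Add rr ra ;; Write aSel rr rq ;;
        Op rq Add rq rone ;; Op rt Lt rq rn ;; Skip)).

(** At each test, row [rp] begins with [s[k .. j]], whose last letter is still unknown. [rg] tells
    whether the strings before and after dropping [s[k]] carry the same order. *)
Definition descend : cmd :=
  Op rp Add ri rzero ;; Const rk 0 ;; Op ru Lt rk rj ;;
  While ru
    (Op rk1 Add rk rone ;; 
     Op rl Defs.Sub rj rk ;; Defs.Choice rf aS rk rl ;;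
     Op rl Defs.Sub rj rk1 ;; Defs.Choice rg aS rk1 rl ;; Op rg Defs.Eq rf rg ;;
     Read rc aS rk ;; Read ra aC rk ;; Read rb aLo rk ;; Op ro Defs.Sub rp rb ;;
     Seq (If rg
            (Read rb aLo rk1 ;; Rank rr rc rb ;; Op rr Add rr ro ;; Skip)
            (Read rb aUp rk1 ;; Rank rr rc rb ;; Op rr Defs.Sub rr rone ;;
             Op rr Defs.Sub rr ro ;; Skip))
       (Op rr Add ra rr ;; Read rp aSel rr ;; Op rk Add rk rone ;; Op ru Lt rk rj ;; Skip)).

(** The first column is sorted by the order of the empty string. If that is the reversal of [pi],
    row [p] is mirrored to [n - 1 - p], which falls in the block of the same letter for [pi]. *)
Definition emit : cmd :=
  Defs.Choice rf aS rzero rzero ;;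
  Seq (If rf (Op rp Defs.Sub rn rp ;; Op rp Defs.Sub rp rone ;; Skip) Skip)
    (Read rq aSel rp ;; Access rc rq ;; Write aS rj rc ;;
     Seq count_smaller
       (Write aC rj ra ;; Rank rl rc rn ;;
        Seq (If rf
               (Op re Defs.Sub rn ra ;; Op rb Defs.Sub re rl ;; Skip)
               (Op rb Add ra rzero ;; Op re Add ra rl ;; Skip))
          (Op rk1 Add rj rone ;; Write aLo rk1 rzero ;; Write aUp rk1 rn ;;
           Write aLo rj rb ;; Write aUp rj re ;; Skip))).

(* Runs k downwards and in place, so the interval of s[k+1 .. j) that is being
   overwritten is kept in rob and roe. *)
Definition update_ranges : cmd :=
  Const rob 0 ;; Op roe Add rn rzero ;; Op rk Add rj rzero ;;
  While rk
    (Op rk1 Add rk rzero ;; Op rk Defs.Sub rk rone ;;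
     Op rl Defs.Sub rj rk ;; Defs.Choice rf aS rk rl ;;
     Op rl Defs.Sub rj rk1 ;; Defs.Choice rg aS rk1 rl ;; Op rg Defs.Eq rf rg ;;
     Read rc aS rk ;; Rank rx rc rb ;; Rank ry rc re ;;
     Seq (If rg
            (Rank rz rc rob ;; Op rz Defs.Sub rx rz ;; Skip)
            (Rank rz rc roe ;; Op rz Defs.Sub rz ry ;; Skip))
       (Op ry Defs.Sub ry rx ;; Read rob aLo rk ;; Read roe aUp rk ;;
        Op rb Add rob rz ;; Op re Add rb ry ;;
        Write aLo rk rb ;; Write aUp rk re ;; Skip)).

Definition invert_bwt : cmd :=
  Const rone 1 ;; Const rzero 0 ;;
  Seq build_select
    (Const rj 0 ;; Write aLo rj rzero ;; Write aUp rj rn ;; Op rt Lt rj rn ;;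
     While rt
       (Seq descend
          (Seq emit
             (Seq update_ranges (Op rj Add rj rone ;; Op rt Lt rj rn ;; Skip))))).

(** * Automation for register contents and frame conditions *)

Ltac read_reg :=
  lazymatch goal with
  | |- regs (set_reg _ ?x _) ?x = _ => simple apply regs_set_same
  | |- regs (set_reg _ _ _) _ = _ =>
      simple apply regs_set_other; [reflexivity | read_reg]
  | |- regs (set_mem _ _ _ _) _ = _ => simple apply regs_set_mem; read_reg
  | |- regs ?st' _ = _ =>
      first [ eassumption
            | match goal with
              | pr : preserved _ _ st' |- _ =>
                  refine (etrans (pr _ _) _); [reflexivity | read_reg]
              end ]
  end.

Ltac keep :=
  match goal with
  | |- preserved _ ?st ?st' => constr_eq st st'; simple apply preserved_refl
  | |- preserved _ _ (set_reg _ _ _) =>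
      simple apply preserved_set_reg; [reflexivity | keep]
  | |- preserved _ _ (set_mem _ _ _ _) => simple apply preserved_set_mem; keep
  | |- _ => eassumption
  | pr : preserved _ _ ?st' |- preserved _ _ ?st' =>
      refine (preserved_trans _ _ pr); [reflexivity | keep]
  end.

(* All registers but those holding n, i, 1, 0 and j. *)
Local Notation scratch := (iota 5 23) (only parsing).

(** * Loop invariants, correctness and running time *)

Section Verification.

Variables (w sigma : nat) (s : seq 'I_sigma) (pi : alpha_order sigma).
Variables (ord : local_orders sigma) (reversed : seq 'I_sigma -> bool) (x0 : 'I_sigma).
Variable i : nat.

Let n := size s.
Let L := bwt ord s.
Let inp := Input L pi reversed.
(** The two interval arrays have an extra cell because the empty string is stored at index [j],
    which reaches [n]. *)
Let lens := [:: n; n; n; n.+1; n.+1].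
Let lo := lower ord s.
Let up := upper ord s.
Let smaller := smaller L pi.
Let lf := lf L pi x0.

Hypothesis n_word : n < 2 ^ w.
Hypothesis w_gt0 : 0 < w.
Hypothesis n_gt0 : 0 < n.
Hypothesis ord_pm : pm_ordering ord pi reversed.
Hypothesis row_i : nth [::] (bwt_matrix ord s) i = s.
Hypothesis lt_i : i < n.

Let size_L : size L = n. Proof. exact: size_bwt. Qed.

Local Notation runs := (runs w inp lens).

Lemma count_smaller_runs st (c : 'I_sigma) :
  regs st rc = c -> regs st rn = n -> regs st rone = 1 ->
  runs count_smaller st (7 * n + 5)
    (fun st' => [/\ regs st' ra = smaller c, preserved [:: rpc; ra; rm; ru; rv] st st'
                  & Defs.mem st' = Defs.mem st]).
Proof.
move=> stc stn st1.
(* Six instructions and a test per round, four instructions before the loop, and the last test. *)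
rewrite (_ : 7 * n + 5 = (n * 7).+1.+4); last by rewrite mulnC; lia.
eapply runs_position; [read_reg|].
eapply runs_const; [lia|].
eapply runs_const; [lia|].
eapply runs_lt; [exact: w_gt0|read_reg|read_reg|].
pose Inv k st' := [/\ regs st' ra = count (fun a => pi a < pi c) (take k L),
  regs st' rpc = pi c, regs st' rm = k, regs st' ru = (k < n)
  & preserved [:: rpc; ra; rm; ru; rv] st st' /\ Defs.mem st' = Defs.mem st].
apply: (@runs_while _ _ _ _ _ _ Inv n 6) => //.
- by split; [rewrite take0|..|split; [keep|]]; try read_reg.
- move=> k st' ltk [va vpc vm vu [pr me]]; split; first by rewrite vu ltk.
  eapply (runs_access (x0 := x0)); [read_reg|by rewrite /= size_L|].
  eapply runs_position; [read_reg|].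
  eapply runs_lt; [exact: w_gt0|read_reg|read_reg|].
  eapply runs_add; [read_reg|read_reg| |].
    apply: leq_ltn_trans n_word; apply: (@leq_trans (k + 1)); last by lia.
    apply: leq_add; last by case: (_ < _).
    by rewrite (leq_trans (count_size _ _)) // size_takel // size_L ltnW.
  eapply runs_add; [read_reg|read_reg|by lia|].
  eapply runs_lt; [exact: w_gt0|read_reg|read_reg|].
  apply: runs_skip; rewrite addn1; split; try read_reg; last by split; [keep|].
  by rewrite (take_nth x0) ?size_L // -cats1 count_cat /= addn0.
- move=> st' [va _ _ vu [pr me]]; rewrite vu ltnn; split => //; split => //.
  by rewrite va -size_L take_size.
Qed.

Definition select_ok (m : array -> nat -> nat) := forall q, q < n -> m aSel (lf q) = q.

Lemma build_select_runs st :
  regs st rn = n -> regs st rone = 1 ->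
  runs build_select st (n * (7 * n + 13) + 3)
    (fun st' => preserved scratch st st' /\ select_ok (Defs.mem st')).
Proof.
move=> stn st1; rewrite (_ : _ + 3 = (n * (7 * n + 12).+1).+1.+2); last by lia.
eapply runs_const; [lia|].
eapply runs_lt; [exact: w_gt0|read_reg|read_reg|].
pose Inv k st' := [/\ regs st' rq = k, regs st' rt = (k < n), preserved scratch st st'
  & forall q, q < k -> Defs.mem st' aSel (lf q) = q].
apply: (@runs_while _ _ _ _ _ _ Inv n (7 * n + 12)) => //.
- by split; [read_reg|read_reg|keep|].
- move=> k st' ltk [vq vt pr sel]; split; first by rewrite vt ltk.
  rewrite (_ : 7 * n + 12 = (7 * n + 5 + 6).+1); last by lia.
  eapply (runs_access (x0 := x0)); [read_reg|by rewrite /= size_L|].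
  eapply runs_then; [apply: count_smaller_runs; read_reg|exact: leqnn|].
  move=> st2 [va pr2 me2] /=; have kL : k < size L by rewrite size_L.
  have := lf_lt pi x0 kL; rewrite size_L => lt_lf.
  eapply runs_rank; [read_reg|read_reg|by rewrite /= size_L ltnW|].
  eapply runs_add; [read_reg|read_reg| |].
    by rewrite /= addnC (ltn_trans lt_lf).
  rewrite /= [_ + smaller _]addnC.
  eapply (runs_write (a := lf k)); [read_reg|read_reg|by []|].
  eapply runs_add; [read_reg|read_reg|by lia|].
  eapply runs_lt; [exact: w_gt0|read_reg|read_reg|].
  apply: runs_skip; rewrite addn1; split; [read_reg|read_reg|keep|].
  move=> q /=; rewrite ltnS leq_eqVlt => /orP[/eqP -> | ltq]; first by rewrite eqxx.
  (* Writing at [lf k] spares the earlier entries, since [lf] is injective. *)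
  case: eqP => [e | _]; last by rewrite me2 /= sel.
  by apply/esym/(lf_inj (pi := pi) (x0 := x0) _ _ e); rewrite size_L //; lia.
- by move=> st' [_ vt pr sel]; rewrite vt ltnn.
Qed.

Lemma ord_same u v : reversed u = reversed v -> ord u = ord v.
Proof. by move=> e; rewrite !ord_pm e. Qed.

Lemma ord_opposite u v a b :
  reversed u != reversed v -> precedes (ord u) a b = precedes (ord v) b a.
Proof.
by rewrite !ord_pm; case: (reversed u); case: (reversed v) => //; rewrite precedes_reversal.
Qed.

Lemma up_le y : up y <= n. Proof. exact: upper_le. Qed.

Lemma lo_le y : lo y <= n.
Proof. exact: leq_trans (lower_le_upper _ _ _) (up_le y). Qed.

(* Letters [q < j] of [s] are known; the ranges stored at [q >= k] are those of
   [s[q .. j)], and those stored at [q < k] still lack the last letter. *)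
Record mem_ok (j k : nat) (m : array -> nat -> nat) : Prop := MemOk {
  mem_sel : select_ok m;
  mem_str : forall q, q < j -> m aS q = nth x0 s q;
  mem_cnt : forall q, q < j -> m aC q = smaller (nth x0 s q);
  mem_lo : forall q, q <= j -> m aLo q = lo (slice s q (if q < k then j.-1 else j));
  mem_up : forall q, q <= j -> m aUp q = up (slice s q (if q < k then j.-1 else j)) }.

Lemma mem_slice (m : array -> nat -> nat) j k l :
  (forall q, q < j -> m aS q = nth x0 s q) -> j <= n ->
  k <= l -> l <= j ->
  [seq m aS q | q <- iota k (l - k)] = [seq val c | c <- slice s k l].
Proof.
move=> ms lej lekl lelj; have len := leq_trans lelj lej.
apply: (@eq_from_nth _ 0); rewrite !size_map size_iota ?size_slice // => q ltq.
rewrite !(nth_map x0) ?size_slice // (nth_map 0) ?size_iota // nth_iota //.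
by rewrite ms ?nth_take ?nth_drop //; lia.
Qed.

Lemma rank_bwt_le c b : rank L c b <= n.
Proof. by rewrite -size_L (leq_trans (rank_le_count _ _ _)) ?count_size. Qed.

Lemma descend_runs j st : j < n ->
  regs st rn = n -> regs st ri = i -> regs st rone = 1 -> regs st rzero = 0 ->
  regs st rj = j -> mem_ok j 0 (Defs.mem st) ->
  runs descend st (j * 21 + 5)
    (fun st' => [/\ preserved scratch st st', Defs.mem st' = Defs.mem st
      & lo [:: nth x0 s j] <= regs st' rp < up [:: nth x0 s j]]).
Proof.
move=> ltj stn sti st1 st0 stj ok; have lejn := ltnW ltj.
rewrite (_ : _ + 5 = (j * 21).+1.+4); last by lia.
eapply runs_add; [read_reg|read_reg|by lia|]; rewrite addn0.
eapply runs_const; [lia|].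
eapply runs_lt; [exact: w_gt0|read_reg|read_reg|].
(* The invariant already involves [s[j]], which the machine does not know yet. For [k = 0] it holds
   because row [i] is [s]; for [k = j] it puts the row in the interval of the single letter
   [s[j]]. *)
pose Inv k st' := [/\ regs st' rk = k, regs st' ru = (k < j), preserved scratch st st',
  Defs.mem st' = Defs.mem st
  & lo (slice s k j.+1) <= regs st' rp < up (slice s k j.+1)].
apply: (@runs_while _ _ _ _ _ _ Inv j 20) => //.
- split; [read_reg|read_reg|keep|by []|].
  rewrite (_ : regs _ rp = i); last by read_reg.
  by rewrite row_in_range ?size_slice ?subn0 // row_i /slice subn0 drop0.
- move=> k st' ltk [vk vu pr me rg]; split; first by rewrite vu ltk.
  set c := nth x0 s k; set d := nth x0 s j; set y := slice s k.+1 j.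
  have ekj : slice s k j = c :: y by rewrite (slice_cons x0).
  have ek1j1 : slice s k.+1 j.+1 = rcons y d by rewrite (slice_rcons x0).
  have ekj1 : slice s k j.+1 = c :: rcons y d.
    by rewrite (slice_cons x0) ?ek1j1 //; lia.
  have szy : (size y).+1 < size s by rewrite size_slice //; lia.
  move: rg; rewrite ekj1; set p := regs st' rp => rg.
  have vp : regs st' rp = p by [].
  have [msel mstr mcnt mlo mup] := ok; rewrite -me in mstr mcnt mlo mup msel.
  have lop : lo (c :: y) <= p.
    apply: leq_trans (proj1 (andP rg)).
    by rewrite -rcons_cons; apply: leq_lower_rcons.
  have lpn : p < n by apply: leq_trans (proj2 (andP rg)) (up_le _).
  eapply runs_add; [read_reg|read_reg|by lia|]; rewrite addn1.
  eapply runs_sub; [read_reg|read_reg|by lia|by lia|].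
  eapply (runs_choice (y := slice s k j)); [read_reg|read_reg|by rewrite /=; lia| |].
    by apply: (mem_slice mstr) => //; lia.
  eapply runs_sub; [read_reg|read_reg|by lia|by lia|].
  eapply (runs_choice (y := y)); [read_reg|read_reg|by rewrite /=; lia| |].
    by apply: (mem_slice mstr) => //; lia.
  eapply runs_eq; [exact: w_gt0|read_reg|read_reg|].
  eapply runs_read; [read_reg|by rewrite /=; lia|exact: mstr|].
  eapply runs_read; [read_reg|by rewrite /=; lia|exact: mcnt|].
  eapply runs_read; [read_reg|by rewrite /=; lia|by apply: mlo; lia|].
  rewrite ltn0 ekj.
  eapply runs_sub; [read_reg|read_reg|by []|by lia|].
  match goal with |- runs _ ?st1 _ _ =>
    apply: (@runs_then _ _ _ _ _ _ _ 5 5 _ (fun st2 => exists r,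
     [/\ regs st2 rr = r, preserved [:: rb; rr] st1 st2, Defs.mem st2 = Defs.mem st'
       & rank L c (lo (rcons y d)) <= r < rank L c (up (rcons y d))])) => //
  end.
    eapply runs_if; [read_reg| |].
      move=> same; have eo : ord (c :: y) = ord y.
        by apply: ord_same; move: same => /=; do 2!case: (reversed _).
      have [_ rgr] := descend_same szy eo rg.
      eapply runs_read; [read_reg|by rewrite /=; lia|by apply: mlo; lia|].
      rewrite ltn0.
      eapply runs_rank; [read_reg|read_reg|by rewrite /= size_L lo_le|].
      eapply runs_add; [read_reg|read_reg| |].
        apply: leq_ltn_trans n_word; apply: leq_trans (rank_bwt_le c (up (rcons y d))).
        exact: ltnW (proj2 (andP rgr)).
      apply: runs_skip; eexists; split; [read_reg|keep|by []|exact: rgr].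
    move=> diff; have eo a b : precedes (ord (c :: y)) a b = precedes (ord y) b a.
      by apply: ord_opposite; move: diff => /=; do 2!case: (reversed _).
    (* [lto] justifies both machine subtractions: the rank is positive, and one less than it is
       still at least the offset. *)
    have [_ lto rgr] := descend_opposite szy eo rg.
    eapply runs_read; [read_reg|by rewrite /=; lia|by apply: mup; lia|].
    rewrite ltn0.
    have := rank_bwt_le c (up y) => rkn.
    eapply runs_rank; [read_reg|read_reg|by rewrite /= size_L up_le|].
    eapply runs_sub; [read_reg|read_reg|by apply: leq_ltn_trans lto| |].
      by apply: leq_ltn_trans n_word.
    eapply runs_sub; [read_reg|read_reg| | |].
      by rewrite -ltnS subn1 prednK //; apply: leq_ltn_trans lto.
      by apply: leq_ltn_trans n_word; apply: leq_trans (leq_subr _ _) rkn.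
    apply: runs_skip; eexists; split; [read_reg|keep|by []|exact: rgr].
  move=> st2 [r [vr pr2 me2 rgr]].
  have ltr : r < count_mem c L.
    by apply: leq_trans (rank_le_count _ _ _); apply: (proj2 (andP rgr)).
  (* The table cell about to be read, [smaller c + r], equals [lf q] where [q] holds the occurrence
     of [c] of rank [r]. *)
  have [q [ltq qc qr qlf]] := select_lf pi x0 ltr.
  have lt_lf := lf_lt pi x0 ltq; rewrite size_L qlf in lt_lf; rewrite size_L in ltq.
  eapply runs_add; [read_reg|read_reg|by apply: ltn_trans n_word|].
  eapply (runs_read (v := q)); [read_reg|by []|by rewrite /= me2 -qlf msel|].
  eapply runs_add; [read_reg|read_reg|by lia|]; rewrite addn1.
  eapply runs_lt; [exact: w_gt0|read_reg|read_reg|].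
  apply: runs_skip; split; [read_reg|read_reg|keep|by rewrite /= me2|].
  rewrite ek1j1 (_ : regs _ rp = q); last by read_reg.
  by apply: rank_between qc _; rewrite ?size_L // qr.
- move=> st' [_ vu pr me]; rewrite (slice_rcons x0) // slice_nil vu ltnn => rg.
  by split.
Qed.

Lemma letter_up (d : 'I_sigma) : up [:: d] = lo [:: d] + rank L d n.
Proof. by rewrite -size_L rank_size; apply: upper1. Qed.

Lemma letter_lo (d : 'I_sigma) : ~~ reversed [::] -> lo [:: d] = smaller d.
Proof. by move=> rev; rewrite /lo lower1 // ord_pm (negPf rev). Qed.

(** Under the reversal, the letters before [d] are those after it in [pi], the complement of the
    smaller and equal ones. *)
Lemma letter_lo_reversed (d : 'I_sigma) :
  reversed [::] -> lo [:: d] + (smaller d + rank L d n) = n.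
Proof.
move=> rev; rewrite /lo lower1 // ord_pm rev -size_L rank_size -(greater_count L pi d).
by congr addn; apply: eq_count => a; rewrite precedes_reversal.
Qed.

Lemma emit_runs j st : j < n ->
  regs st rn = n -> regs st rone = 1 -> regs st rzero = 0 -> regs st rj = j ->
  mem_ok j 0 (Defs.mem st) ->
  lo [:: nth x0 s j] <= regs st rp < up [:: nth x0 s j] ->
  runs emit st (7 * n + 24)
    (fun st' => [/\ preserved scratch st st', mem_ok j.+1 j (Defs.mem st'),
      regs st' rb = lo [:: nth x0 s j] & regs st' re = up [:: nth x0 s j]]).
Proof.
move=> ltj stn st1 st0 stj [msel mstr mcnt mlo mup]; set d := nth x0 s j.
set p := regs st rp => rgp; have stp : regs st rp = p by [].
have sc : smaller d + rank L d n <= n by rewrite -size_L rank_size smaller_count_le.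
have ltp : p < n by apply: leq_trans (proj2 (andP rgp)) (up_le _).
rewrite (_ : 7 * n + 24 = (4 + (7 * n + 19)).+1); last by lia.
eapply (runs_choice (y := [::])); [read_reg|read_reg|by []|by []|].
(* Both orders of the empty string lead to a cell [smaller d + r] in the block of [d]. Which
   occurrence of [d] it selects is immaterial, as only the letter is read. *)
match goal with |- runs _ ?st1 _ _ =>
  apply: (@runs_then _ _ _ _ _ _ _ 4 (7 * n + 19) _ (fun st2 => exists r,
    [/\ regs st2 rp = smaller d + r, preserved [:: rp] st1 st2,
        Defs.mem st2 = Defs.mem st & r < rank L d n])) => //
end.
  eapply runs_if; [read_reg| |] => /= rev.
    have e := letter_lo_reversed d rev; have e' := letter_up d.
    eapply runs_sub; [read_reg|read_reg|by lia|by lia|].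
    eapply runs_sub; [read_reg|read_reg|by lia|by lia|].
    (* The offset of the mirrored row inside the block of [d]. *)
    apply: runs_skip; exists (n - p - 1 - smaller d); split; [|keep|by []|].
      rewrite subnKC; first by read_reg.
      by move: rgp; rewrite e'; lia.
    by move: rgp; rewrite e'; lia.
  have e := letter_lo d rev; have e' := letter_up d.
  apply: runs_skip; exists (p - smaller d); split; [|keep|by []|].
    by rewrite subnKC; [read_reg|rewrite -e; case/andP: rgp].
  by move: rgp; rewrite e' e; lia.
move=> st2 [r [vp pr2 me2 ltr]].
rewrite -size_L rank_size in ltr.
have [q [ltq qd qr qlf]] := select_lf pi x0 ltr.
have lt_lf := lf_lt pi x0 ltq; rewrite size_L qlf in lt_lf.
have ltqn : q < n by rewrite -size_L.
rewrite (_ : 7 * n + 19 = (7 * n + 5 + 11).+3); last by lia.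
eapply (runs_read (v := q)); [read_reg|by []|by rewrite me2 -qlf msel|].
eapply (runs_access (x0 := x0)); [read_reg|by []|]; rewrite [nth _ _ _]qd.
eapply runs_write; [read_reg|read_reg|by []|].
eapply runs_then; [apply: (count_smaller_runs (c := d)); read_reg|exact: leqnn|].
move=> st3 [va pr3 me3].
eapply runs_write; [read_reg|read_reg|by []|].
eapply runs_rank; [read_reg|read_reg|by rewrite /= size_L|].
rewrite -[in_bwt inp]/L.
match goal with |- runs _ ?st1 _ _ =>
  apply: (@runs_then _ _ _ _ _ _ _ 4 5 _ (fun st2 =>
    [/\ regs st2 rb = lo [:: d], regs st2 re = up [:: d], preserved [:: rb; re] st1 st2
       & Defs.mem st2 = Defs.mem st1])) => //
end.
  eapply runs_if; [read_reg| |] => /= rev.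
    have e := letter_lo_reversed d rev; have e' := letter_up d.
    eapply runs_sub; [read_reg|read_reg|by lia|by lia|].
    eapply runs_sub; [read_reg|read_reg|by lia|by lia|].
    apply: runs_skip; split; [| |keep|by []].
      by rewrite (_ : lo _ = n - smaller d - rank L d n); [read_reg|lia].
    by rewrite (_ : up _ = n - smaller d); [read_reg|lia].
  have e := letter_lo d rev; have e' := letter_up d.
  eapply runs_add; [read_reg|read_reg|by lia|]; rewrite addn0.
  eapply runs_add; [read_reg|read_reg|by lia|].
  by apply: runs_skip; split; [rewrite e|rewrite e' e|keep|]; try read_reg.
move=> st4 [vb ve pr4 me4].
eapply runs_add; [read_reg|read_reg|by lia|]; rewrite addn1.
eapply runs_write; [read_reg|read_reg|by []|].
eapply runs_write; [read_reg|read_reg|by []|].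
eapply runs_write; [read_reg|read_reg|exact: ltnW|].
eapply runs_write; [read_reg|read_reg|exact: ltnW|].
apply: runs_skip; split; [keep| |read_reg|read_reg].
split => [q' ltq'|q' ltq'|q' ltq'|q' ltq'|q' ltq'] /=; rewrite ?me4 /= ?me3 /= ?me2.
- exact: msel.
- case: eqP => [-> // | /eqP neq].
  by rewrite mstr // ltn_neqAle neq -ltnS.
- case: eqP => [-> // | /eqP neq].
  by rewrite mcnt // ltn_neqAle neq -ltnS.
(* Three cases: cell [j] holds the interval of the new letter alone, cell [j.+1] that of the empty
   string, and the cells below [j] still lack the new letter. *)
- case: eqP => [-> | /eqP neq].
    by rewrite ltnn (slice_rcons x0) // slice_nil.
  case: eqP => [-> | /eqP neq1].
    by rewrite ltnNge leqnSn /= slice_nil /lo lower_nil.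
  by rewrite (_ : q' < j) ?mlo ?ltn0 //; lia.
- case: eqP => [-> | /eqP neq].
    by rewrite ltnn (slice_rcons x0) // slice_nil.
  case: eqP => [-> | /eqP neq1].
    by rewrite ltnNge leqnSn /= slice_nil /up upper_nil.
  by rewrite (_ : q' < j) ?mup ?ltn0 //; lia.
Qed.

Lemma update_ranges_runs j st : j < n ->
  regs st rn = n -> regs st rone = 1 -> regs st rzero = 0 -> regs st rj = j ->
  mem_ok j.+1 j (Defs.mem st) ->
  regs st rb = lo [:: nth x0 s j] -> regs st re = up [:: nth x0 s j] ->
  runs update_ranges st (j * 23 + 4)
    (fun st' => preserved scratch st st' /\ mem_ok j.+1 0 (Defs.mem st')).
Proof.
move=> ltj stn st1 st0 stj ok stb ste; have lejn := ltnW ltj.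
rewrite (_ : _ + 4 = (j * 23).+4); last by lia.
eapply runs_const; [lia|].
eapply runs_add; [read_reg|read_reg|by lia|]; rewrite addn0.
eapply runs_add; [read_reg|read_reg|by lia|]; rewrite addn0.
(* After [m] rounds [k = j - m]; [rb], [re] hold the interval of [s[k .. j]] and [rob], [roe] the
   old one of [s[k .. j)]. At the start the latter is the empty string, whence 0 and [n]. *)
pose Inv m st' := let k := j - m in [/\ preserved scratch st st',
  mem_ok j.+1 k (Defs.mem st'), regs st' rk = k
  & [/\ regs st' rb = lo (slice s k j.+1), regs st' re = up (slice s k j.+1),
        regs st' rob = lo (slice s k j) & regs st' roe = up (slice s k j)]].
apply: (@runs_while _ _ _ _ _ _ Inv j 22) => //.
- rewrite /Inv subn0 (slice_rcons x0) // slice_nil -[rcons [::] _]/[:: nth x0 s j].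
  split; [keep|by []|read_reg|].
  by rewrite /lo /up lower_nil upper_nil; split; read_reg.
- move=> m st' ltm; rewrite /Inv (_ : j - m = (j - m.+1).+1); last by lia.
  have ltk : j - m.+1 < j by lia.
  move: (j - m.+1) ltk => k ltk [pr [msel mstr mcnt mlo mup] vk [vb ve vob voe]].
  split; first by rewrite vk.
  set c := nth x0 s k; set d := nth x0 s j; set y := slice s k.+1 j.
  have ekj : slice s k j = c :: y by rewrite (slice_cons x0).
  have ek1j1 : slice s k.+1 j.+1 = rcons y d by rewrite (slice_rcons x0).
  have ekj1 : slice s k j.+1 = c :: rcons y d.
    by rewrite (slice_cons x0) ?ek1j1 //; lia.
  have szy : (size y).+1 < size s by rewrite size_slice //; lia.
  rewrite ek1j1 in vb ve; rewrite -/y in vob voe.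
  have leul : lo (rcons y d) <= up (rcons y d) by exact: lower_le_upper.
  have leu := up_le (c :: rcons y d).
  have ranku := rank_bwt_le c (up y); have ranku' := rank_bwt_le c (up (rcons y d)).
  have rankl' := leq_rank L c leul.
  have K3 : up (c :: rcons y d) + rank L c (lo (rcons y d))
            = lo (c :: rcons y d) + rank L c (up (rcons y d)).
    by apply: upper_cons; rewrite size_rcons.
  eapply runs_add; [read_reg|read_reg|by lia|]; rewrite addn0.
  eapply runs_sub; [read_reg|read_reg|by lia|by lia|]; rewrite subn1 /=.
  eapply runs_sub; [read_reg|read_reg|by lia|by lia|].
  eapply (runs_choice (y := c :: y)); [read_reg|read_reg|by rewrite /=; lia| |].
    by rewrite -ekj; apply: (mem_slice mstr) => //; lia.
  eapply runs_sub; [read_reg|read_reg|by lia|by lia|].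
  eapply (runs_choice (y := y)); [read_reg|read_reg|by rewrite /=; lia| |].
    by apply: (mem_slice mstr) => //; lia.
  eapply runs_eq; [exact: w_gt0|read_reg|read_reg|].
  eapply (runs_read (v := c)); [read_reg|by rewrite /=; lia|by apply: mstr; lia|].
  eapply runs_rank; [read_reg|read_reg|by rewrite /= size_L lo_le|].
  eapply runs_rank; [read_reg|read_reg|by rewrite /= size_L up_le|].
  rewrite -[in_bwt inp]/L.
  (* In both branches [z] is the offset of the interval of [cyd] inside that of [cy]. *)
  match goal with |- runs _ ?st1 _ _ =>
    apply: (@runs_then _ _ _ _ _ _ _ 4 8 _ (fun st2 => exists z,
     [/\ regs st2 rz = z, preserved [:: rz] st1 st2, Defs.mem st2 = Defs.mem st'
       & lo (c :: rcons y d) = lo (c :: y) + z])) => //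
  end.
    eapply runs_if; [read_reg| |] => /=.
      move=> same; have eo : ord (c :: y) = ord y.
        by apply: ord_same; move: same => /=; do 2!case: (reversed _).
      have K1 : lo (c :: rcons y d) + rank L c (lo y)
                = lo (c :: y) + rank L c (lo (rcons y d)) by apply: lower_cons_same.
      have lel : rank L c (lo y) <= rank L c (lo (rcons y d)).
        by apply: leq_rank; apply: leq_lower_rcons; apply: ltnW.
      eapply runs_rank; [read_reg|read_reg|by rewrite /= size_L lo_le|].
      rewrite -[in_bwt inp]/L.
      eapply runs_sub; [read_reg|read_reg|by []|by lia|].
      by apply: runs_skip; eexists; split; [read_reg|keep|by []|lia].
    move=> diff; have eo a b : precedes (ord (c :: y)) a b = precedes (ord y) b a.
      by apply: ord_opposite; move: diff => /=; do 2!case: (reversed _).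
    have K2 : lo (c :: rcons y d) + rank L c (up (rcons y d))
              = lo (c :: y) + rank L c (up y) by apply: lower_cons_opposite.
    have leu' : rank L c (up (rcons y d)) <= rank L c (up y).
      rewrite [leqRHS](@rank_upper_rcons _ _ _ x0 y d c) ?leq_addr //.
      exact: ltnW.
    eapply runs_rank; [read_reg|read_reg|by rewrite /= size_L up_le|].
    rewrite -[in_bwt inp]/L.
    eapply runs_sub; [read_reg|read_reg|by []|by lia|].
    by apply: runs_skip; eexists; split; [read_reg|keep|by []|lia].
  move=> st2 [z [vz pr2 me2 ez]].
  (* Cell [k] has not been overwritten yet, so it still describes [cy] without the letter [d]. *)
  have rd_lo : Defs.mem st2 aLo k = lo (c :: y).
    by rewrite me2 mlo ?ltnSn ?ekj //; lia.
  have rd_up : Defs.mem st2 aUp k = up (c :: y).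
    by rewrite me2 mup ?ltnSn ?ekj //; lia.
  eapply runs_sub; [read_reg|read_reg|by []|by lia|].
  eapply runs_read; [read_reg|by rewrite /=; lia|exact: rd_lo|].
  eapply runs_read; [read_reg|by rewrite /=; lia|exact: rd_up|].
  eapply runs_add; [read_reg|read_reg|by lia|]; rewrite -ez.
  eapply runs_add; [read_reg|read_reg|by lia|].
  (* By [K3] the number of [c]'s inside [yd] is the width of the interval of [cyd]. *)
  rewrite (_ : _ + (_ - _) = up (c :: rcons y d)); last by lia.
  eapply runs_write; [read_reg|read_reg|by rewrite /=; lia|].
  eapply runs_write; [read_reg|read_reg|by rewrite /=; lia|].
  apply: runs_skip; rewrite ekj ekj1; split; [keep| |read_reg|by split; read_reg].
  split => [q' ltq'|q' ltq'|q' ltq'|q' ltq'|q' ltq'] /=; rewrite ?me2.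
  + exact: msel.
  + exact: mstr.
  + exact: mcnt.
  + case: eqP => [-> | /eqP neq]; first by rewrite ltnn ekj1.
    by rewrite mlo // ltnS leq_eqVlt (negPf neq).
  + case: eqP => [-> | /eqP neq]; first by rewrite ltnn ekj1.
    by rewrite mup // ltnS leq_eqVlt (negPf neq).
- by move=> st' [pr]; rewrite subnn => ok' vk _.
Qed.

Lemma invert_bwt_runs :
  runs invert_bwt (init n i) (200 * n ^ 2)
    (fun st => output n st = [seq val a | a <- s]).
Proof.
apply: (@runs_weaken _ _ _ _ _ _ (n * (7 * n + 13) + 3 + (n * (51 * n + 36)).+1.+4).+2).
- by rewrite expnS expn1; have := n_gt0; nia.
- by move=> st; apply.
eapply runs_const; [lia|].
eapply runs_const; [lia|].
eapply runs_then; [apply: build_select_runs|exact: leqnn|]; try read_reg; try by [].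
move=> st [pr sel].
have stn : regs st rn = n by rewrite pr.
have sti : regs st ri = i by rewrite pr.
eapply runs_const; [lia|].
eapply runs_write; [read_reg|read_reg|by []|].
eapply runs_write; [read_reg|read_reg|by []|].
eapply runs_lt; [exact: w_gt0|read_reg|read_reg|].
pose Inv j st' := [/\ regs st' rn = n, regs st' ri = i, regs st' rone = 1,
  regs st' rzero = 0 & [/\ regs st' rj = j, regs st' rt = (j < n)
  & mem_ok j 0 (Defs.mem st')]].
(* A round costs at most [21 * j + 5] to descend, [7 * n + 24] to emit, [23 * j + 4] to update and 2
   more, with [j < n]. *)
apply: (@runs_while _ _ _ _ _ _ Inv n (51 * n + 35)) => //.
- split; try read_reg; split; try read_reg.
  split=> // q; rewrite ?leqn0 //= => /eqP ->; rewrite eqxx slice_nil.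
    by rewrite /lo lower_nil.
  by rewrite /up upper_nil.
- move=> j st1 ltj [vn vi v1 v0 [vj vt ok]]; split; first by rewrite vt ltj.
  eapply (runs_then (T2 := 7 * n + 24 + (j * 23 + 4 + 2)));
    [apply: (descend_runs ltj); read_reg || exact: ok|lia|].
  move=> st2 [pr2 me2 rg].
  eapply runs_then; [apply: (emit_runs ltj); try read_reg|exact: leqnn|].
  + by rewrite me2.
  + by [].
  move=> st3 [pr3 ok3 vb ve].
  eapply runs_then; [apply: (update_ranges_runs ltj); read_reg || exact: ok3|exact: leqnn|].
  move=> st4 [pr4 ok4].
  eapply runs_add; [read_reg|read_reg|by lia|]; rewrite addn1.
  eapply runs_lt; [exact: w_gt0|read_reg|read_reg|].
  by apply: runs_skip; split; try read_reg; split; try read_reg.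
- move=> st' [_ _ _ _ [_ vt ok]]; rewrite vt ltnn; split=> //.
  have := mem_slice (mem_str ok) (leqnn n) (leq0n n) (leqnn n).
  by rewrite subn0 /slice subn0 drop0 take_size.
- by rewrite -addnS.
Qed.

End Verification.

Theorem theorem16 (c : nat) :
  exists (P : cmd) (C : nat),
    forall (w n sigma : nat),
      n < 2 ^ w -> sigma <= 2 ^ w -> sigma <= w ^ c ->
    forall (s : n.-tuple 'I_sigma) (pi : alpha_order sigma)
           (ord : local_orders sigma) (reversed : seq 'I_sigma -> bool)
           (i : 'I_n),
      primitive_string s ->
      pm_ordering ord pi reversed ->
      nth [::] (bwt_matrix ord s) i = s ->
      retrieves w (Input (bwt ord s) pi reversed) i P s (C * n ^ 2) (C * n).
Proof.
(* One constant serves both bounds; the space is [5 * n + 2] words, and [n] is positive because it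
   bounds the row index. *)
exists invert_bwt, 200 => w n sigma n_w _ _ s pi ord reversed i _ pm row_i.
have n_gt0 : 0 < n by case: (i) => m; apply: leq_ltn_trans.
have w_gt0 : 0 < w by case: w n_w => //; rewrite expn0 ltnS leqNgt n_gt0.
have sz := size_tuple s; rewrite -sz in n_w n_gt0.
have lt_i : i < size s by rewrite sz.
(* [tnth s i] merely supplies a default letter. *)
have [t [st [ex le_t out]]] :=
  invert_bwt_runs (tnth s i) n_w w_gt0 n_gt0 pm row_i lt_i.
exists [:: size s; size s; size s; (size s).+1; (size s).+1], t, st; split => //.
  by rewrite sz in le_t.
by rewrite /= sz; lia.
Qed.
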